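(* For every $j\in\mathbb{Z}$, the subspace $W_j:=\mathbb{C}[e_i\mid i\in\mathbb{Z}]\,|j\sqrt2\rangle$ of $L_{(0,1)}$ satisfies $$W_j=\mathbb{C}[e_i\mid i\le -2j-1]\,|j\sqrt2\rangle=\mathbb{C}^F_1[e_i\mid i\le -2j-1]\,|j\sqrt2\rangle .$$
   Context: The Lie algebra $\widehat{\mathfrak{sl}}_2'=\mathfrak{sl}_2\otimes\mathbb{C}[t,t^{-1}]\oplus\mathbb{C}K$ has basis $e_n,f_n,h_n$ ($n\in\mathbb{Z}$), $K$, and brackets $[e_n,e_m]=[f_n,f_m]=0$, $[e_n,f_m]=h_{n+m}+n\delta_{n,-m}K$, $[h_n,e_m]=2e_{n+m}$, $[h_n,f_m]=-2f_{n+m}$, $[h_n,h_m]=2n\delta_{n,-m}K$, $K$ central. Put $\hat{\mathfrak n}_+=\langle e_0\rangle+\sum_{k>0}t^k\mathfrak{sl}_2$. The module $L_{(0,1)}$ is the irreducible module with cyclic vector $v$ such that $\hat{\mathfrak n}_+v=0$, $h_0v=0$, $Kv=v$. Realization of $L_{(0,1)}$: let $a_n$ ($n\in\mathbb{Z}$) satisfy $[a_n,a_m]=n\delta_{n+m,0}$, and let $F_\lambda$ be the bosonic Fock module generated by $|\lambda\rangle$ with $a_n|\lambda\rangle=0$ for $n>0$ and $a_0|\lambda\rangle=\lambda|\lambda\rangle$. Then $L_{(0,1)}=\bigoplus_{m\in\mathbb{Z}}F_{m\sqrt2}$, with $K=1$ and with currents $x(z)=\sum_n x_nz^{-n-1}$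 ($x=e,f,h$) acting by $e(z)={:}\exp(\sqrt2\varphi(z)){:}$, $f(z)={:}\exp(-\sqrt2\varphi(z)){:}$, $h(z)=\sqrt2\,\partial\varphi(z)$, where $\varphi(z)=q+a_0\log z+\sum_{n\ne0}\frac{a_n}{-n}z^{-n}$, $[a_0,q]=1$, $q$ commutes with $a_n$ for $n\neq 0$, and $\exp(\pm\sqrt2 q)|\lambda\rangle=|\lambda\pm\sqrt2\rangle$. Normal ordering puts $q$ and $a_n$, $n<0$, to the left of $a_n$, $n\ge0$. The highest weight vector is $|0\rangle$. Since the $e_i$ commute, polynomials in commuting variables $e_i$ act on $L_{(0,1)}$. A monomial $e_{j_1}e_{j_2}\cdots e_{j_k}$ is a Fibonacci-1 monomial if $j_m-j_{m-1}>1$ for all $m\in\{2,\dots,k\}$ (the constant monomial $1$, $k=0$, is included). For $N\in\mathbb{Z}$, $\mathbb{C}^F_1[e_i\mid i\le N]$ denotes the linear span of the Fibonacci-1 monomials in the variables $e_i$ with $i\le N$. For a set $A$ of polynomials and a vector $w$, $A\,w=\{g\,w: g\in A\}$. *)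

(* Defs.v *)
From HB Require Import structures.
From mathcomp Require Import all_boot all_order all_algebra.
From mathcomp Require Import finmap monalg complex.
From mathcomp Require Import classical_sets reals.

Set Implicit Arguments.
Unset Strict Implicit.
Unset Printing Implicit Defensive.

Import Order.TTheory GRing.Theory Num.Theory.

Local Open Scope classical_set_scope.
Local Open Scope ring_scope.

Section LinearAlgebra.
Context (F : fieldType).

(* {malg F[K]} is the free vector space on K, with basis the << k >>. *)
Definition lin_ext (K : choiceType) (V : lmodType F) (phi : K -> V)
    (g : {malg F[K]}) : V :=
  \sum_(k <- msupp g) g@_k *: phi k.

Definition lin_span (V : lmodType F) (A : set V) : set V :=
  [set v | exists2 s : seq (F * V),
     (forall x, x \in s -> A x.2) & v = \sum_(x <- s) x.1 *: x.2].

Variables (V : lmodType F) (x : nat -> V -> V).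

(* The coefficient of z^p in the r-th power of the operator-valued series
   x_1 z + x_2 z^2 + ... *)
Fixpoint pow_coef (r p : nat) (v : V) : V :=
  match r with
  | 0%N => if p == 0%N then v else 0
  | r'.+1 => \sum_(1 <= k < p.+1) x k (pow_coef r' (p - k)%N v)
  end.

(* The coefficient of z^p in exp (x_1 z + x_2 z^2 + ...); the r-th power
   starts in degree r, so that only r <= p contributes. *)
Definition exp_coef (p : nat) (v : V) : V :=
  \sum_(r < p.+1) (r`!%:R)^-1 *: pow_coef r p v.

End LinearAlgebra.

Section Realization.
Context (R : realType).
Local Notation C := R[i].

Definition sqrt2 : C := Complex (Num.sqrt 2) 0.

(* The index (m, mu) stands for the vector
     (\prod_i a_(-(i+1)) ^ (mu i)) |m sqrt 2>
   of the Fock module F_(m sqrt 2). Those vectors, for fixed m, are a basis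
   of F_(m sqrt 2), so that L01 is the direct sum of the F_(m sqrt 2). *)
Definition fock_index : choiceType := (int * {cmonom nat})%type.

Definition L01 : lmodType C := {malg C[fock_index]}.

(* |m sqrt 2>; the highest weight vector is vac 0. *)
Definition vac (m : int) : L01 := << (m, mone) >>.

(* On F_lambda, identified with the polynomials in the a_(-n), n > 0, the
   operator a_(-n) is the multiplication by a_(-n), a_n is n times the
   derivation with respect to a_(-n), and a_0 is the scalar lambda. *)
Definition a_ (n : int) : L01 -> L01 :=
  match n with
  | Posz 0 => lin_ext (fun b : fock_index => (sqrt2 * b.1%:~R) *: << b >>)
  | Posz i.+1 => lin_ext (fun b : fock_index =>
      (i.+1 * b.2 i)%N%:R *: << (b.1, divcm b.2 (ucm i)) >>)
  | Negz i => lin_ext (fun b : fock_index => << (b.1, mmul b.2 (ucm i)) >>)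
  end.

(* exp (s sqrt2 q) *)
Definition shift (s : int) : L01 -> L01 :=
  lin_ext (fun b : fock_index => << (b.1 + s, b.2) >>).

(* The coefficient of z^p in exp (s sqrt2 \sum_(n > 0) (a_(-n) / n) z^n) *)
Definition creation_part (s : int) (p : nat) : L01 -> L01 :=
  exp_coef (fun n v => (s%:~R * sqrt2 / n%:R) *: a_ (- n%:Z) v) p.

(* The coefficient of z^(-k) in exp (- s sqrt2 \sum_(n > 0) (a_n / n) z^(-n)) *)
Definition annihilation_part (s : int) (k : nat) : L01 -> L01 :=
  exp_coef (fun n v => (- (s%:~R * sqrt2 / n%:R)) *: a_ n%:Z v) k.

Definition fock_weight (mu : {cmonom nat}) : nat :=
  (\sum_(i <- finsupp mu) i.+1 * mu i)%N.

(* The coefficient of z^(-n-1) in :exp (s sqrt2 phi(z)):, which is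
     exp (s sqrt2 q) exp (s sqrt2 \sum_(n > 0) (a_(-n) / n) z^n)
       exp (- s sqrt2 \sum_(n > 0) (a_n / n) z^(-n)) z^(s sqrt2 a_0).
   On F_(m sqrt 2) the last factor is z^(2 s m), hence the equation
   p - k + 2 s m = - n - 1 for the powers z^p and z^(-k) contributed by the
   other factors. The k-th annihilation coefficient lowers fock_weight by k,
   so that the omitted terms k > fock_weight vanish. *)
Definition vertex_mode (s n : int) : L01 -> L01 :=
  lin_ext (fun b : fock_index =>
    \sum_(k < (fock_weight b.2).+1)
      if k%:Z - 2 * s * b.1 - n - 1 is Posz p
      then shift s (creation_part s p (annihilation_part s k << b >>))
      else 0).

(* The modes of the currents e(z), f(z), h(z); K acts as 1. *)
Definition e_ (n : int) : L01 -> L01 := vertex_mode 1 n.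
Definition f_ (n : int) : L01 -> L01 := vertex_mode (- 1) n.
Definition h_ (n : int) (v : L01) : L01 := sqrt2 *: a_ n v.

(* The commutative polynomials in variables indexed by int. *)
Definition epoly : lmodType C := {malg C[{cmonom int}]}.

(* As the operators e_ i commute, the order of the factors is immaterial;
   the monomial acts as e_(j_1) ... e_(j_k) with j_1 <= ... <= j_k. *)
Definition emonom_act (m : {cmonom int}) (w : L01) : L01 :=
  foldr (fun i => iter (m i) (e_ i)) w (sort <=%O (finsupp m)).

Definition epoly_act (g : epoly) (w : L01) : L01 :=
  lin_ext (fun m : {cmonom int} => emonom_act m w) g.

Definition epoly_orbit (A : set epoly) (w : L01) : set L01 :=
  (fun g => epoly_act g w) @` A.

Definition emonom_le (N : int) (m : {cmonom int}) : Prop :=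
  forall i, i \in finsupp m -> i <= N.

(* C[e_i | i <= N] *)
Definition epoly_le (N : int) : set epoly :=
  [set g | forall m, m \in msupp g -> emonom_le N m].

Definition fibonacci1 (m : {cmonom int}) : Prop :=
  exists2 js : seq int, sorted (fun i j => 1 < j - i) js &
    m = \big[mmul/mone]_(j <- js) ucm j.

(* C^F_1[e_i | i <= N] *)
Definition epoly_fib1 (N : int) : set epoly :=
  lin_span ((fun m => << m >> : epoly)
    @` [set m | fibonacci1 m /\ emonom_le N m]).

Definition W (j : int) : set L01 := epoly_orbit setT (vac j).

End Realization.

(* Main.v *)
Require Import Defs.
From HB Require Import structures.
From mathcomp Require Import all_boot all_order all_algebra.
From mathcomp Require Import finmap monalg complex.
From mathcomp Require Import classical_sets reals.
From mathcomp Require Import zify ring.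

(** The theorem rests on two facts about the current e(z): its modes commute,
    and e(z)^2 = 0.  Both are read off from the normally ordered form of
    e(z) e(w).  Write
    e(z) = S C(z) A(z) z^(sqrt2 a_0), with S the lattice shift, C(z) the
    exponential of the creation operators and A(z) that of the annihilation
    operators.  Since [a_n, a_(-n)] = n and sqrt2^2 = 2, moving A(z) to the
    right of C(w) costs the factor (1 - w/z)^2 ([exp_coefz_exchange]), so that
    up to shifts and powers of z and w
      e(z) e(w) = (z - w)^2 C(z) C(w) A(z) A(w).
    The right-hand side is symmetric in z and w, which is commutation
    ([mode_pairC], [e_commute]), and it vanishes on z = w, which is
      \sum_(a + b = T) e_a e_b = 0
    ([sum_mode_pair], [e_square]).  The coefficients of (z - w)^2 are those of
    a second difference along the line a + b = T, so that the vanishing is a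
    telescoping sum of a finitely supported sequence.  This way everything is
    an identity between finite sums of operators, applied to one vector.

    On |j sqrt2> the operators e_n with n > N = -2j-1 vanish for degree
    reasons ([e_vac]), and by commutation they vanish on all of W_j.  Hence
    only monomials in the e_(N - d), d >= 0, matter, and on W_j the
    quadratic relation only involves such indices.  If a monomial is not
    Fibonacci, it contains e_(N - a) e_(N - b) with b = a or b = a + 1; this is
    the term of the relation for T = a + b that minimizes the sum of squares of
    the two indices d.  Solving for it rewrites the monomial in monomials with
    the same number of factors, the same sum of the d and a larger sum of
    squares.  As the sum of squares is at most the square of the sum, this
    terminates ([straightening]), and all of W_j is spanned by Fibonacci
    monomials.  The inclusions in the other direction are trivial. *)

Set Implicit Arguments.
Unset Strict Implicit.
Unset Printing Implicit Defensive.

Import Order.TTheory GRing.Theory Num.Theory.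

Local Open Scope ring_scope.

(** * Coefficients of the exponential of an operator series *)

Section ExponentialSeries.
Context (F : numFieldType) (V : lmodType F) (x : nat -> {linear V -> V}).

(** Degrees are extended to the integers, with coefficient 0 in negative degree:
    the triangular sums of products of series then become rectangular, with any
    large enough bound M, and can be exchanged and shifted freely. *)
Definition pow_coefz (r : nat) (p : int) (v : V) : V :=
  if p is Posz n then pow_coef x r n v else 0.

Definition exp_coefz (p : int) (v : V) : V :=
  if p is Posz n then exp_coef x n v else 0.

Let xZ k a w : x k (a *: w) = a *: x k w. Proof. exact: linearZ. Qed.

Let xD k v w : x k (v + w) = x k v + x k w. Proof. exact: linearD. Qed.

Lemma pow_coef_is_linear r p : linear (pow_coef x r p).
Proof.
elim: r p => [|r IHr] p a u v /=; first by case: ifP; rewrite ?scaler0 ?addr0.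
rewrite scaler_sumr -big_split /=; apply: eq_bigr => k _.
by rewrite IHr linearP.
Qed.

Lemma pow_coefz_is_linear r p : linear (pow_coefz r p).
Proof.
by case: p => n a u v /=; rewrite ?scaler0 ?addr0 ?pow_coef_is_linear.
Qed.

HB.instance Definition _ r p :=
  GRing.isLinear.Build F V V _ (pow_coefz r p) (pow_coefz_is_linear r p).

Lemma exp_coefz_is_linear p : linear (exp_coefz p).
Proof.
case: p => n a u v /=; rewrite ?scaler0 ?addr0 // /exp_coef scaler_sumr.
rewrite -big_split /=; apply: eq_bigr => r _.
by rewrite pow_coef_is_linear scalerDr !scalerA mulrC.
Qed.

HB.instance Definition _ p :=
  GRing.isLinear.Build F V V _ (exp_coefz p) (exp_coefz_is_linear p).

Lemma exp_coefzZ p a v : exp_coefz p (a *: v) = a *: exp_coefz p v.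
Proof. exact: linearZ. Qed.

Lemma exp_coefz_sum p I (r : seq I) (P : pred I) (G : I -> V) :
  exp_coefz p (\sum_(i <- r | P i) G i) =
  \sum_(i <- r | P i) exp_coefz p (G i).
Proof. exact: linear_sum. Qed.

Lemma pow_coefzS r (p : int) M v : p <= M%:Z ->
  pow_coefz r.+1 p v = \sum_(k < M) x k.+1 (pow_coefz r (p - k.+1%:Z) v).
Proof.
case: p => n leM /=; last by rewrite big1 // => k _; rewrite linear0.
rewrite big_add1 /= big_mkord (big_ord_widen M (fun k =>
  x k.+1 (pow_coef x r (n - k.+1) v))) ?lez_nat //.
rewrite big_mkcond; apply: eq_bigr => k _; case: ifP => lekn.
  by rewrite /pow_coefz subzn.
have -> : n%:Z - k.+1%:Z = Negz (k - n) by lia.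
by rewrite linear0.
Qed.

Lemma pow_coef_gt r p v : (p < r)%N -> pow_coef x r p v = 0.
Proof.
elim: r p => [//|r IHr] p ltpr /=.
rewrite big_nat_cond big1 // => k; rewrite andbT => /andP[k0 kp].
by rewrite IHr ?linear0 //; lia.
Qed.

Hypothesis xC : forall i j v, x i.+1 (x j.+1 v) = x j.+1 (x i.+1 v).

(** Coefficientwise, z d/dz x(z)^r = r (z x'(z)) x(z)^(r-1).  Commutation of the
    x_k is what moves the differentiated factor to the front. *)
Lemma pow_coefz_deriv r (p : int) M v : p <= M%:Z ->
  p%:~R *: pow_coefz r p v =
  r%:R *: \sum_(k < M) k.+1%:R *: x k.+1 (pow_coefz r.-1 (p - k.+1%:Z) v).
Proof.
elim: r p => [|r IHr] p lepM.
  by rewrite scale0r; case: p {lepM} => [[|n]|n] /=; rewrite ?scale0r ?scaler0.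
rewrite (pow_coefzS _ _ lepM) -natr1 scalerDl scale1r addrC scaler_sumr.
have split_p k (w : V) :
    p%:~R *: w = k.+1%:R *: w + (p - k.+1%:Z)%:~R *: w.
  by rewrite -scalerDl pmulrn -intrD addrC subrK.
under eq_bigr => k _.
  rewrite (split_p k) -[X in _ + X]xZ IHr; last by lia.
  rewrite xZ linear_sum.
  over.
rewrite big_split /=; congr (_ + _).
rewrite -scaler_sumr exchange_big /=; case: r {IHr} => [|r]; rewrite ?scale0r //.
congr (_ *: _); apply: eq_bigr => l _.
rewrite (@pow_coefzS _ _ M) /=; last by lia.
rewrite linear_sum scaler_sumr; apply: eq_bigr => k _.
rewrite xZ xC; congr (_ *: x _ (x _ (pow_coefz _ _ v))); lia.
Qed.

Lemma exp_coefzEw (p : int) M v : p < M%:Z ->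
  exp_coefz p v = \sum_(r < M) (r`!%:R)^-1 *: pow_coefz r p v.
Proof.
case: p => n /= ltnM; last by rewrite big1 // => k _; rewrite scaler0.
rewrite /exp_coef (big_ord_widen M (fun r => (r`!%:R)^-1 *: pow_coef x r n v)) //.
rewrite big_mkcond; apply: eq_bigr => r _; case: ifP => // nr.
by rewrite pow_coef_gt ?scaler0 //; lia.
Qed.

(** Coefficientwise, z d/dz exp (x(z)) = (z x'(z)) exp (x(z)).  In
    characteristic 0 this recursion determines the coefficients of positive
    degree, and replaces the explicit exponential in all later inductions. *)
Lemma exp_coefz_deriv (p : int) M v : p <= M%:Z ->
  p%:~R *: exp_coefz p v =
  \sum_(k < M) k.+1%:R *: x k.+1 (exp_coefz (p - k.+1%:Z) v).
Proof.
move=> lepM; rewrite (@exp_coefzEw _ M.+1) ?ltz_nat; last by lia.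
rewrite big_ord_recl scalerDr scaler_sumr.
under eq_bigr => r _.
  rewrite scalerA mulrC -scalerA (pow_coefz_deriv _ _ lepM) scalerA /=.
  rewrite /bump add1n factS natrM invfM mulrAC mulVf ?mul1r ?pnatr_eq0 //.
  rewrite scaler_sumr.
  over.
(* The constant term x(z)^0 lives in degree 0, where the factor p vanishes. *)
have -> : p%:~R *: (((ord0 : 'I_M.+1)`!)%:R^-1 *: pow_coefz (ord0 : 'I_M.+1) p v) = 0.
  rewrite scalerA mulrC -scalerA; case: p {lepM} => [[|n]|n] /=;
  by rewrite ?scale0r ?scaler0.
rewrite add0r exchange_big; apply: eq_bigr => k _ /=.
rewrite (@exp_coefzEw _ M) ?linear_sum ?scaler_sumr /=; last by lia.
by apply: eq_bigr => r _; rewrite xZ !scalerA mulrC.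
Qed.

Lemma exp_coefz_lt0 (p : int) v : p < 0 -> exp_coefz p v = 0.
Proof. by case: p. Qed.

Lemma exp_coefz0 v : exp_coefz 0 v = v.
Proof. by rewrite /= /exp_coef big_ord1 /= fact0 invr1 scale1r. Qed.

(** If [T, x(z)] = c z^(n+1) is a scalar then [T, exp (x(z))] is that scalar
    times exp (x(z)). *)
Lemma exp_coefz_commutator (T : {linear V -> V}) (n : nat) c :
    (forall k v, T (x k.+1 v) = x k.+1 (T v) + (if k == n then c *: v else 0)) ->
  forall (p : int) v,
    T (exp_coefz p v) = exp_coefz p (T v) + c *: exp_coefz (p - n.+1%:Z) v.
Proof.
move=> Tx; case=> p v; last by rewrite /= linear0 scaler0 addr0.
have TZ a w : T (a *: w) = a *: T w by exact: linearZ.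
elim/ltn_ind: p v => -[|p] IHp v.
  by rewrite !exp_coefz0 sub0r /= scaler0 addr0.
have IHz (q : int) w : q < p.+1%:Z ->
    T (exp_coefz q w) = exp_coefz q (T w) + c *: exp_coefz (q - n.+1%:Z) w.
  by case: q => q ltqp; [apply: IHp | rewrite /= linear0 scaler0 addr0].
have p1_neq0 : (p.+1%:~R : F) != 0 by rewrite intr_eq0.
apply: (scalerI p1_neq0); rewrite scalerDr -TZ.
have leM : p.+1%:Z <= (p.+1 + n.+1)%N%:Z by lia.
have leM' : p.+1%:Z - n.+1%:Z <= (p.+1 + n.+1)%N%:Z by lia.
(* A bound that also exceeds n, so that the term k = n is always present. *)
set N := (p.+1 + n.+1)%N in leM leM'.
pose q k := p.+1%:Z - k.+1%:Z.
rewrite !(exp_coefz_deriv _ leM) linear_sum /=.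
rewrite (eq_bigr (fun k : 'I_N =>
    k.+1%:R *: x k.+1 (exp_coefz (q k) (T v)) +
    c *: (k.+1%:R *: x k.+1 (exp_coefz (q n - k.+1%:Z) v)) +
    (if k == n :> nat then (k.+1%:R * c) *: exp_coefz (q n) v else 0))).
  rewrite 2!big_split /= -addrA; congr (_ + _).
  rewrite -scaler_sumr -exp_coefz_deriv //.
  have ltnN : (n < N)%N by rewrite /N; lia.
  rewrite -big_mkcond (big_pred1 (Ordinal ltnN)) //=.
  rewrite !scalerA -scalerDl; congr (_ *: _).
  by rewrite /q rmorphB /= -pmulrn; ring.
move=> k _; rewrite TZ Tx IHz; last by rewrite /q; lia.
rewrite xD xZ !scalerDr -/(q k); congr (_ + _ + _).
  rewrite !scalerA mulrC; congr (_ *: x _ (exp_coefz _ v)); rewrite /q; lia.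
by case: eqP => [->|_]; rewrite ?scaler0 // scalerA.
Qed.

Lemma exp_coefz_commC (p q : int) v :
  exp_coefz p (exp_coefz q v) = exp_coefz q (exp_coefz p v).
Proof.
have xE k w : x k.+1 (exp_coefz q w) = exp_coefz q (x k.+1 w).
  rewrite (@exp_coefz_commutator (x k.+1) 0 0) ?scale0r ?addr0 //.
  by move=> l u; rewrite xC scale0r if_same addr0.
rewrite (@exp_coefz_commutator (exp_coefz q) 0 0) ?scale0r ?addr0 //.
by move=> l u; rewrite xE scale0r if_same addr0.
Qed.

End ExponentialSeries.

Arguments exp_coefz : simpl never.

(** * Exchange of creation and annihilation exponentials *)

Lemma sum_second_difference (U : zmodType) (g : nat -> U) M :
  \sum_(n < M) (g n - g n.+1 *+ 2 + g n.+2) = g M.+1 - g M - (g 1%N - g 0%N).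
Proof.
rewrite -(big_mkord xpredT (fun n => g n - g n.+1 *+ 2 + g n.+2)).
rewrite -(telescope_sumr (fun n => g n.+1 - g n) (leq0n M)).
by apply: eq_bigr => n _; rewrite mulr2n opprB opprD [LHS]addrC (addrCA (g n)) addrA.
Qed.

Lemma second_difference_addC (U : zmodType) (p q r u w z : U) :
  p - u *+ 2 - (q - w *+ 2) *+ 2 + (r - z *+ 2) =
  p - q *+ 2 + r - (u - w *+ 2 + z) *+ 2.
Proof.
rewrite (mulrnDl 2 _ z) !mulrnBl !opprD !opprK [RHS]addrACA; congr (_ + _).
exact: addrACA.
Qed.

Lemma sum_shift (U : zmodType) (f : int -> U) M j M' :
  (forall k : int, k < 0 -> f k = 0) ->
  (forall k : nat, (M <= k)%N -> f k%:Z = 0) -> (M + j <= M')%N ->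
  \sum_(k < M') f (k%:Z - j%:Z) = \sum_(k < M) f k%:Z.
Proof.
move=> f_lt0 f_geM; elim: j M' => [|j IHj] M' leM'.
  rewrite (big_ord_widen M' (fun k => f k%:Z)); last by rewrite addn0 in leM'.
  rewrite [RHS]big_mkcond /=; apply: eq_bigr => k _; rewrite subr0.
  by case: ltnP => // /f_geM.
case: M' leM' => [|M'] leM'; first by rewrite addnS in leM'.
rewrite big_ord_recl f_lt0 ?add0r; last by rewrite /=; lia.
rewrite -(IHj M'); last by rewrite addnS in leM'.
by apply: eq_bigr => k _; congr f; rewrite lift0; lia.
Qed.

(** The constant -2/(k+1) is [- sqrt2 a_n / n, sqrt2 a_(-n) / n] for n = k+1,
    the exponents of the two halves of the vertex operator. *)
Section Heisenberg.
Context (F : numFieldType) (V : lmodType F) (x y : nat -> {linear V -> V}).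
Hypothesis xC : forall i j v, x i.+1 (x j.+1 v) = x j.+1 (x i.+1 v).
Hypothesis yC : forall i j v, y i.+1 (y j.+1 v) = y j.+1 (y i.+1 v).
Hypothesis yx : forall k l v, y k.+1 (x l.+1 v) =
  x l.+1 (y k.+1 v) + (if l == k then (- (2 / k.+1%:R)) *: v else 0).

(** A(z) C(w) = (1 - w/z)^2 C(w) A(z), where C = exp x and A = exp y: the scalar
    commutator of the exponents is -2 \sum_n (w/z)^n / n, the logarithm of
    (1 - w/z)^2.  The proof is by induction on k with the recursion for A; the
    corrections from moving each y_i across C telescope. *)
Lemma exp_coefz_exchange (k p : int) v :
  exp_coefz y k (exp_coefz x p v) =
  exp_coefz x p (exp_coefz y k v)
    - exp_coefz x (p - 1) (exp_coefz y (k - 1) v) *+ 2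
    + exp_coefz x (p - 2) (exp_coefz y (k - 2) v).
Proof.
case: k => k; last by rewrite !(exp_coefz_lt0 y) // !linear0 mul0rn subr0 addr0.
elim/ltn_ind: k p v => -[|k] IHk p v.
  by rewrite !exp_coefz0 !(exp_coefz_lt0 y) // !linear0 mul0rn subr0 addr0.
have IHz (q : int) p' w : q < k.+1%:Z ->
    exp_coefz y q (exp_coefz x p' w) = exp_coefz x p' (exp_coefz y q w)
    - exp_coefz x (p' - 1) (exp_coefz y (q - 1) w) *+ 2
    + exp_coefz x (p' - 2) (exp_coefz y (q - 2) w).
  case: q => q ltq; first exact: IHk.
  by rewrite !(exp_coefz_lt0 y) // !linear0 mul0rn subr0 addr0.
have k1_neq0 : (k.+1%:~R : F) != 0 by rewrite intr_eq0.
have ycomm n q w : n.+1%:R *: y n.+1 (exp_coefz x q w) =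
    exp_coefz x q (n.+1%:R *: y n.+1 w) - exp_coefz x (q - n.+1%:Z) w *+ 2.
  rewrite (exp_coefz_commutator xC (yx n)) scalerDr exp_coefzZ; congr (_ + _).
  rewrite scalerA mulrN mulrCA divff ?pnatr_eq0 // mulr1 scaleNr.
  by rewrite -scaler_nat.
apply: (scalerI k1_neq0).
rewrite scalerDr scalerBr.
have leM : k.+1%:Z <= k.+1%:Z by [].
rewrite (exp_coefz_deriv yC _ leM).
rewrite (eq_bigr (fun i : 'I_k.+1 =>
  (exp_coefz x p (i.+1%:R *: y i.+1 (exp_coefz y (k.+1%:Z - i.+1%:Z) v))
   - exp_coefz x (p - 1)
       (i.+1%:R *: y i.+1 (exp_coefz y (k.+1%:Z - 1 - i.+1%:Z) v)) *+ 2
   + exp_coefz x (p - 2)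
       (i.+1%:R *: y i.+1 (exp_coefz y (k.+1%:Z - 2 - i.+1%:Z) v)))
  - (exp_coefz x (p - i.+1%:Z) (exp_coefz y (k.+1%:Z - i.+1%:Z) v)
     - exp_coefz x (p - i.+2%:Z) (exp_coefz y (k.+1%:Z - i.+2%:Z) v) *+ 2
     + exp_coefz x (p - i.+3%:Z) (exp_coefz y (k.+1%:Z - i.+3%:Z) v)) *+ 2)).
  pose H (n : nat) := exp_coefz x (p - n%:Z) (exp_coefz y (k.+1%:Z - n%:Z) v).
  have sumy (n : nat) :
    \sum_(i < k.+1) exp_coefz x (p - n%:Z)
        (i.+1%:R *: y i.+1 (exp_coefz y (k.+1%:Z - n%:Z - i.+1%:Z) v)) =
    k.+1%:~R *: H n - n%:~R *: H n.
    rewrite -scalerBl -rmorphB /= -exp_coefzZ (@exp_coefz_deriv _ _ _ yC _ k.+1).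
      by rewrite linear_sum.
    by lia.
  have sum0 := sumy 0%N; rewrite !subr0 scale0r subr0 in sum0.
  rewrite sumrB sumrMnl big_split /= sumrB sumrMnl.
  rewrite sum0 (sumy 1%N) (sumy 2%N).
  rewrite (sum_second_difference (fun n => H n.+1)).
  (* The far end of the telescoping sum has negative annihilation degree. *)
  have H0 n : (k.+1 < n)%N -> H n = 0.
    move=> ltkn; rewrite /H.
    have -> : k.+1%:Z - n%:Z = Negz (n - k.+2) by lia.
    by rewrite (exp_coefz_lt0 y) ?linear0.
  cbv beta; rewrite (H0 k.+2) // (H0 k.+3) // subr0 sub0r opprB scale1r.
  rewrite -[RHS]/(k.+1%:~R *: exp_coefz x p (exp_coefz y k.+1%:Z v)
    - k.+1%:~R *: (H 1%N *+ 2) + k.+1%:~R *: H 2%N).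
  rewrite [2%:~R *: _](scaler_nat 2) mulrnBl [in X in _ - X = _]mulrnBl scalerMnr.
  rewrite [H 0%N]/H !subr0 !opprB -addrA subrKA -addrA (addrC (H 1%N *+ 2 - _)).
  by rewrite subrKA addrA addrAC.
move=> i _.
have yD a b c : i.+1%:R *: y i.+1 (a - b *+ 2 + c) =
  i.+1%:R *: y i.+1 a - (i.+1%:R *: y i.+1 b) *+ 2 + i.+1%:R *: y i.+1 c.
  rewrite [y _ (_ + c)]linearD [y _ (a - _)]linearB [y _ (b *+ _)]linearMn.
  by rewrite scalerDr scalerBr scalerMnr.
rewrite IHz; last by lia.
rewrite yD !ycomm.
have idx2 (q : int) : q - i.+2%:Z = q - 1 - i.+1%:Z by lia.
have idx3 (q : int) : q - i.+3%:Z = q - 2 - i.+1%:Z by lia.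
rewrite !idx2 !idx3.
rewrite !(addrAC k.+1%:Z (- i.+1%:Z)); exact: second_difference_addC.
Qed.

Local Notation C := (exp_coefz x).
Local Notation A := (exp_coefz y).

(** The coefficient of z^X in C(z) A(z).  The truncation at M loses nothing on a
    vector that A(z) kills in degrees k >= M. *)
Definition mode_sum (M : nat) (X : int) (v : V) : V :=
  \sum_(k < M) C (k%:Z + X) (A k%:Z v).

(** The coefficient of z^X w^Y in C(z) C(w) A(z) A(w). *)
Definition normal_pair (M : nat) (X Y : int) (v : V) : V :=
  \sum_(k < M) \sum_(l < M) C (k%:Z + X) (C (l%:Z + Y) (A k%:Z (A l%:Z v))).

(** The coefficient of z^X w^Y in (z - w)^2 C(z) C(w) A(z) A(w). *)
Definition mode_pair (M : nat) (X Y : int) (v : V) : V :=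
  normal_pair M (X - 2) Y v - normal_pair M (X - 1) (Y - 1) v *+ 2
    + normal_pair M X (Y - 2) v.

Lemma normal_pairC M X Y v : normal_pair M X Y v = normal_pair M Y X v.
Proof.
rewrite /normal_pair exchange_big; apply: eq_bigr => k _; apply: eq_bigr => l _.
by rewrite (exp_coefz_commC yC) (exp_coefz_commC xC).
Qed.

Lemma normal_pair_eq0 M (X Y : int) v : X + M%:Z <= 0 -> normal_pair M X Y v = 0.
Proof.
move=> leX0; rewrite /normal_pair big1 // => k _; rewrite big1 // => l _.
by apply: exp_coefz_lt0; have := ltn_ord k; lia.
Qed.

Lemma mode_pairC M X Y v : mode_pair M X Y v = mode_pair M Y X v.
Proof.
rewrite /mode_pair (normal_pairC M (X - 2)) (normal_pairC M (X - 1)).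
by rewrite (normal_pairC M X) addrC addrA addrAC.
Qed.

(** The shift of X by 2 is the factor z^2 that turns (1 - w/z)^2 into (z - w)^2;
    on the Fock spaces it is supplied by z^(sqrt2 a_0), as the inner operator
    raises a_0 by sqrt2. *)
Lemma mode_sum_comp M M' X Y v :
    (forall k, (M <= k)%N -> A k%:Z v = 0) -> (M + 2 <= M')%N ->
  mode_sum M' (X - 2) (mode_sum M Y v) = mode_pair M X Y v.
Proof.
move=> Av0 leM'; rewrite /mode_pair /normal_pair /mode_sum.
rewrite [X in _ = X - _ + _]exchange_big [X in _ = _ - X *+ 2 + _]exchange_big.
rewrite [X in _ = _ + X]exchange_big /= -sumrMnl -sumrB -big_split /=.
under eq_bigr => k _ do rewrite [A _ _]exp_coefz_sum [C _ _]exp_coefz_sum.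
rewrite exchange_big; apply: eq_bigr => l _ /=.
have AAv0 (k : nat) : (M <= k)%N -> A k%:Z (A l%:Z v) = 0.
  by move=> leMk; rewrite (exp_coefz_commC yC) Av0 // linear0.
(* f j is the summand of the j-th term of (z - w)^2, already reindexed. *)
pose f j (k : int) :=
  C (k + (X - 2 + j%:Z)) (C (l%:Z + (Y - j%:Z)) (A k (A l%:Z v))).
have sum_f (j : nat) : (j <= 2)%N ->
    \sum_(k < M') f j (k%:Z - j%:Z) = \sum_(k < M) f j k%:Z.
  move=> le2; apply: sum_shift => [k k_lt0|k leMk|].
  - by rewrite /f (exp_coefz_lt0 _ _ k_lt0) !linear0.
  - by rewrite /f AAv0 // !linear0.
  - by lia.
transitivity (\sum_(k < M') f 0%N (k%:Z - 0%:Z)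
  - (\sum_(k < M') f 1%N (k%:Z - 1)) *+ 2 + \sum_(k < M') f 2%N (k%:Z - 2)).
  rewrite -sumrMnl -sumrB -big_split; apply: eq_bigr => k _ /=.
  rewrite exp_coefz_exchange linearD linearB linearMn /= /f.
  congr (_ - _ *+ 2 + _); [congr (C _ (C _ (A _ _))) |
    congr (C _ (C _ (A _ _))) | congr (C _ (C _ (A _ _)))]; lia.
rewrite (sum_f 0%N) // (sum_f 1%N) // (sum_f 2%N) // /f.
by congr (_ - _ *+ 2 + _); apply: eq_bigr => k _;
  congr (C _ (C _ (A _ _))); lia.
Qed.

(** A multiple of (z - w) vanishes at z = w.  Along the line X + Y = const the
    terms of [mode_pair] form a second difference of values of [normal_pair]; the
    bounds on X and Y make the latter vanish at both ends of the window. *)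
Lemma sum_mode_pair M (X Y : int) K v : X + M%:Z <= 1 -> Y + M%:Z <= K%:Z ->
  \sum_(t < K) mode_pair M (X + t%:Z) (Y - t%:Z) v = 0.
Proof.
move=> leX leY.
pose g (t : nat) := normal_pair M (X - 2 + t%:Z) (Y - t%:Z) v.
transitivity (\sum_(t < K) (g t - g t.+1 *+ 2 + g t.+2)).
  apply: eq_bigr => t _; rewrite /mode_pair /g.
  by congr (normal_pair _ _ _ _ - normal_pair _ _ _ _ *+ 2 +
    normal_pair _ _ _ _); lia.
rewrite sum_second_difference /g.
rewrite (normal_pairC M (_ + K%:Z)) (normal_pairC M (_ + K.+1%:Z)).
by rewrite !normal_pair_eq0 ?subrr //; lia.
Qed.

End Heisenberg.

(** * Vectors by their support on a basis *)

Section FreeModule.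
Context (F : fieldType) (K : choiceType).
Local Notation MK := {malg F[K]}.

Lemma malgU_scale (c : F) (k : K) : << c *g k >> = c *: << k >> :> MK.
Proof. by apply/malgP => l; rewrite mcoeffZ !mcoeffU mulrnAr mulr1. Qed.

Section LinearExtension.
Context (V : lmodType F) (phi : K -> V).

Lemma lin_extEw (d : {fset K}) (g : MK) : (msupp g `<=` d)%fset ->
  lin_ext phi g = \sum_(k <- d) g@_k *: phi k.
Proof.
move=> le_gd; rewrite [LHS](big_fset_incl _ le_gd) => //= k _ /mcoeff_outdom ->.
by rewrite scale0r.
Qed.

Lemma lin_extU k : lin_ext phi << k >> = phi k.
Proof.
by rewrite (lin_extEw msuppU_le) big_seq_fset1 mcoeffUU scale1r.
Qed.

Lemma lin_ext_is_linear : linear (lin_ext phi : MK -> V).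
Proof.
move=> c u v; pose d := (msupp u `|` msupp v)%fset.
have ud : (msupp u `<=` d)%fset by apply: fsubsetUl.
have vd : (msupp v `<=` d)%fset by apply: fsubsetUr.
have uvd : (msupp (c *: u + v) `<=` d)%fset.
  apply: fsubset_trans (msuppD_le _ _) _.
  exact/fsetSU/msuppZ_le.
rewrite (lin_extEw ud) (lin_extEw vd) (lin_extEw uvd) scaler_sumr -big_split.
by apply: eq_bigr => k _; rewrite mcoeffD mcoeffZ scalerDl scalerA.
Qed.

HB.instance Definition _ :=
  GRing.isLinear.Build F MK V _ (lin_ext phi) lin_ext_is_linear.

End LinearExtension.

Lemma malg_basis (g : MK) : g = \sum_(k <- msupp g) g@_k *: << k >>.
Proof.
by rewrite {1}[g]monalgE; apply: eq_bigr => k _; rewrite malgU_scale.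
Qed.

Lemma eq_on_basis (V : lmodType F) (f g : {linear MK -> V}) (P : K -> Prop) v :
  (forall k, P k -> f << k >> = g << k >>) ->
  (forall k, k \in msupp v -> P k) -> f v = g v.
Proof.
move=> eq_fg Pv; rewrite [v]malg_basis !linear_sum big_seq [RHS]big_seq.
by apply: eq_bigr => k /Pv Pk; rewrite !linearZ /= eq_fg.
Qed.

Definition supported (P : K -> Prop) (v : MK) :=
  forall k, k \in msupp v -> P k.

Lemma supported0 P : supported P 0.
Proof. by move=> k; rewrite msupp0. Qed.

Lemma supportedD P u v : supported P u -> supported P v -> supported P (u + v).
Proof.
move=> Pu Pv k /(fsubsetP (msuppD_le _ _)).
by rewrite in_fsetU => /orP[/Pu|/Pv].
Qed.

Lemma supportedZ P c v : supported P v -> supported P (c *: v).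
Proof. by move=> Pv k /(fsubsetP (msuppZ_le _ _))/Pv. Qed.

Lemma supportedU (P : K -> Prop) k : P k -> supported P << k >>.
Proof. by move=> Pk l /(fsubsetP msuppU_le); rewrite in_fset1 => /eqP->. Qed.

Lemma supported_sum P I (r : seq I) (Q : pred I) (G : I -> MK) :
  (forall i, Q i -> supported P (G i)) ->
  supported P (\sum_(i <- r | Q i) G i).
Proof. by move=> PG; elim/big_ind: _ => //; [exact: supported0|exact: supportedD]. Qed.

Lemma supported_linear (f : {linear MK -> MK}) (P Q : K -> Prop) v :
  (forall k, P k -> supported Q (f << k >>)) ->
  supported P v -> supported Q (f v).
Proof.
move=> fPQ Pv; rewrite [v]malg_basis linear_sum big_seq.
apply: supported_sum => k /Pv Pk.
by rewrite linearZ /=; apply: supportedZ; apply: fPQ.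
Qed.

Lemma supported_False v : supported (fun=> False) v -> v = 0.
Proof. by move=> v0; rewrite [v]malg_basis big_seq big1 // => k /v0. Qed.

End FreeModule.

(** * The Fock spaces as Heisenberg modules *)

Section MonomialWeight.
Implicit Types mu nu : {cmonom nat}.

Lemma divcmC mu nu nu' : divcm (divcm mu nu) nu' = divcm (divcm mu nu') nu.
Proof. by apply/eqP/cmP => i; rewrite !divcmE subnAC. Qed.

Lemma mulcmK mu nu : divcm (mmul mu nu) nu = mu.
Proof. by apply/eqP/cmP => i; rewrite divcmE cmM addnK. Qed.

Lemma divcmK mu i : (0 < mu i)%N -> mmul (divcm mu (ucm i)) (ucm i) = mu.
Proof.
move=> mui; apply/eqP/cmP => j; rewrite cmM divcmE cmU.
by case: eqP => [<-|_]; rewrite ?subnK // subn0 addn0.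
Qed.

Lemma mulcm_divcmC mu i j : (0 < mu i)%N ->
  divcm (mmul mu (ucm j)) (ucm i) = mmul (divcm mu (ucm i)) (ucm j).
Proof.
move=> mui; apply/eqP/cmP => k; rewrite !(cmM, divcmE) !cmU.
by case: (i =P k) mui => [->|_]; lia.
Qed.

Lemma fock_weightEw mu (d : {fset nat}) : (finsupp mu `<=` d)%fset ->
  fock_weight mu = (\sum_(i <- d) i.+1 * mu i)%N.
Proof.
move=> le; rewrite /fock_weight (big_fset_incl _ le) // => i _.
by rewrite -cmE_neq0 negbK => /eqP ->; rewrite muln0.
Qed.

Lemma fock_weightM mu nu :
  fock_weight (mmul mu nu) = (fock_weight mu + fock_weight nu)%N.
Proof.
have le1 := fsubsetUl (finsupp mu) (finsupp nu).
have le2 := fsubsetUr (finsupp mu) (finsupp nu).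
rewrite (fock_weightEw le1) (fock_weightEw le2) -big_split /fock_weight mdomD.
by apply: eq_bigr => i _; rewrite cmM mulnDr.
Qed.

Lemma fock_weightU i : fock_weight (ucm i) = i.+1.
Proof. by rewrite /fock_weight mdomU big_seq_fset1 cmUU muln1. Qed.

Lemma fock_weight_div mu i : (0 < mu i)%N ->
  fock_weight mu = (fock_weight (divcm mu (ucm i)) + i.+1)%N.
Proof. by move=> mui; rewrite -{1}(divcmK mui) fock_weightM fock_weightU. Qed.

End MonomialWeight.

(** Applied to the filtration by weight, this makes A(z) locally finite; applied
    to a constant filtration, it says that submodules are preserved. *)
Lemma exp_coefz_filtration (F : numFieldType) (V : lmodType F)
    (x : nat -> {linear V -> V}) (P : nat -> V -> Prop) :
    (forall w, P w 0) -> (forall w u v, P w u -> P w v -> P w (u + v)) ->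
    (forall w c v, P w v -> P w (c *: v)) ->
    (forall k w v, P w v -> P (w - k.+1)%N (x k.+1 v)) ->
  forall (p w : nat) v, P w v -> P (w - p)%N (exp_coefz x p%:Z v).
Proof.
move=> P0 PD PZ Px p w v Pv; rewrite /exp_coefz /exp_coef.
elim/big_ind: _ => [|u1 u2|r _]; [exact: P0|exact: PD|apply: PZ].
move: (nat_of_ord r) => {}r; elim: r p => [|r IHr] p /=.
  by case: eqP => // ->; rewrite subn0.
rewrite big_add1 /= big_mkord; elim/big_ind: _ => [|u1 u2|k _].
- exact: P0.
- exact: PD.
have -> : (w - p = w - (p - k.+1) - k.+1)%N by have := ltn_ord k; lia.
exact/Px/IHr.
Qed.

Lemma scaled_commutator (F : fieldType) (V : lmodType F)
    (T S : {linear V -> V}) a b d v : T (S v) = S (T v) + d *: v ->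
  a *: T (b *: S v) = b *: S (a *: T v) + (a * b * d) *: v.
Proof.
move=> TS; rewrite (linearZ_LR T) (linearZ_LR S) TS !scalerDr !scalerA.
by rewrite (mulrC b).
Qed.

Arguments a_ : simpl never.

Section FockSpace.
Context (R : realType).
Local Notation C := R[i].
Local Notation L := (L01 R).

Lemma a_is_linear n : linear (@a_ R n).
Proof. by case: n => [[|n]|n] c u v; rewrite /a_ linearP. Qed.

HB.instance Definition _ n :=
  GRing.isLinear.Build C L L _ (@a_ R n) (a_is_linear n).

Lemma shift_is_linear s : linear (@shift R s).
Proof. exact: lin_ext_is_linear. Qed.

HB.instance Definition _ s :=
  GRing.isLinear.Build C L L _ (@shift R s) (shift_is_linear s).

(** The factor 1 stands for the sign s = 1 of the current e(z): with it the
    exponentials of these operators are [creation_part 1] and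
    [annihilation_part 1] by definition. *)
Definition creation (n : nat) (v : L) : L :=
  (1%:~R * sqrt2 R / n%:R) *: a_ (- n%:Z) v.

Definition annihilation (n : nat) (v : L) : L :=
  (- (1%:~R * sqrt2 R / n%:R)) *: a_ n%:Z v.

Lemma creation_is_linear n : linear (creation n).
Proof.
by move=> c u v; rewrite /creation linearP scalerDr !scalerA mulrC.
Qed.

HB.instance Definition _ n :=
  GRing.isLinear.Build C L L _ (creation n) (creation_is_linear n).

Lemma annihilation_is_linear n : linear (annihilation n).
Proof.
by move=> c u v; rewrite /annihilation linearP scalerDr !scalerA mulrC.
Qed.

HB.instance Definition _ n :=
  GRing.isLinear.Build C L L _ (annihilation n) (annihilation_is_linear n).

(** The index type is fixed here once and for all: for a pair, unification would
    otherwise have to compare different but convertible index structures. *)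
Definition fock_basis (b : fock_index) : L := << b >>.

Lemma a_neg_basis i (b : fock_index) :
  a_ (Negz i) (fock_basis b) = fock_basis (b.1, mmul b.2 (ucm i)).
Proof. exact: lin_extU. Qed.

Lemma a_pos_basis i (b : fock_index) :
  a_ i.+1%:Z (fock_basis b) =
  (i.+1 * b.2 i)%N%:R *: fock_basis (b.1, divcm b.2 (ucm i)).
Proof. exact: lin_extU. Qed.

Lemma a_pos_basis_eq0 i (b : fock_index) : b.2 i = 0%N ->
  a_ i.+1%:Z (fock_basis b) = 0.
Proof. by move=> bi0; rewrite a_pos_basis bi0 muln0 scale0r. Qed.

Lemma shift_basis s (b : fock_index) :
  shift s (fock_basis b) = fock_basis (b.1 + s, b.2).
Proof. exact: lin_extU. Qed.

Lemma fock_ext (f g : {linear L -> L}) v :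
  (forall b : fock_index, f (fock_basis b) = g (fock_basis b)) -> f v = g v.
Proof.
move=> fg; apply: (@eq_on_basis _ _ _ f g (fun=> True)) => // b _; exact: fg.
Qed.

Lemma a_negC i j (v : L) :
  a_ (Negz i) (a_ (Negz j) v) = a_ (Negz j) (a_ (Negz i) v).
Proof.
apply: (@fock_ext (a_ (Negz i) \o a_ (Negz j))
  (a_ (Negz j) \o a_ (Negz i)) v) => b /=.
by rewrite !a_neg_basis /= -!mulmA (mulmC (ucm i)).
Qed.

Lemma a_posC i j (v : L) :
  a_ i.+1%:Z (a_ j.+1%:Z v) = a_ j.+1%:Z (a_ i.+1%:Z v).
Proof.
apply: (@fock_ext (a_ i.+1%:Z \o a_ j.+1%:Z)
  (a_ j.+1%:Z \o a_ i.+1%:Z) v) => b /=.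
rewrite !a_pos_basis !linearZ /= !a_pos_basis /= !scalerA divcmC; congr (_ *: _).
rewrite -!natrM !divcmE !cmU; congr (_%:R).
by case: (eqVneq i j) => [->//|_]; rewrite !subn0 mulnC.
Qed.

(** The canonical commutation relation; [Negz j] is the mode -(j+1). *)
Lemma a_pos_neg i j (v : L) :
  a_ i.+1%:Z (a_ (Negz j) v) =
  a_ (Negz j) (a_ i.+1%:Z v) + (if j == i then i.+1%:R else 0) *: v.
Proof.
apply: (@fock_ext (a_ i.+1%:Z \o a_ (Negz j))
  ((a_ (Negz j) \o a_ i.+1%:Z) \+
     ( *:%R (if j == i then i.+1%:R else 0))) v) => b /=.
rewrite a_neg_basis; case: eqP => [->|ij].
  rewrite a_pos_basis /= cmM cmUU mulcmK -surjective_pairing.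
  case: (posnP (b.2 i)) => [bi0 | bi].
    by rewrite (a_pos_basis_eq0 bi0) linear0 add0r bi0 muln1.
  rewrite a_pos_basis linearZ /= a_neg_basis /= divcmK // -surjective_pairing.
  by rewrite -scalerDl -natrD mulnDr muln1.
rewrite scale0r addr0; case: (posnP (b.2 i)) => [bi0 | bi].
  rewrite (a_pos_basis_eq0 bi0) linear0 a_pos_basis_eq0 //= cmM cmU bi0.
  by case: eqP ij.
rewrite !a_pos_basis linearZ /= a_neg_basis /= (mulcm_divcmC j bi) cmM cmU.
by rewrite (introF eqP ij) addn0.
Qed.

Lemma shift_a_neg s i (v : L) : shift s (a_ (Negz i) v) = a_ (Negz i) (shift s v).
Proof.
apply: (@fock_ext (shift s \o a_ (Negz i)) (a_ (Negz i) \o shift s) v) => b /=.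
by rewrite a_neg_basis !shift_basis a_neg_basis.
Qed.

Lemma shift_a_pos s i (v : L) : shift s (a_ i.+1%:Z v) = a_ i.+1%:Z (shift s v).
Proof.
apply: (@fock_ext (shift s \o a_ i.+1%:Z) (a_ i.+1%:Z \o shift s) v) => b /=.
by rewrite a_pos_basis linearZ /= !shift_basis a_pos_basis.
Qed.

Definition creation_lin n : {linear L -> L} := creation n.
Definition annihilation_lin n : {linear L -> L} := annihilation n.

Lemma creation_linE n v : creation_lin n.+1 v =
  (1%:~R * sqrt2 R / n.+1%:R) *: a_ (Negz n) v.
Proof. by []. Qed.

Lemma annihilation_linE n v : annihilation_lin n.+1 v =
  (- (1%:~R * sqrt2 R / n.+1%:R)) *: a_ n.+1%:Z v.
Proof. by []. Qed.

Lemma creationC i j v : creation_lin i.+1 (creation_lin j.+1 v) =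
  creation_lin j.+1 (creation_lin i.+1 v).
Proof.
rewrite !creation_linE ![a_ _ (_ *: _)]linearZ /= !scalerA a_negC.
by rewrite [in LHS]mulrC.
Qed.

Lemma annihilationC i j v : annihilation_lin i.+1 (annihilation_lin j.+1 v) =
  annihilation_lin j.+1 (annihilation_lin i.+1 v).
Proof.
rewrite !annihilation_linE ![a_ _ (_ *: _)]linearZ /= !scalerA a_posC.
by rewrite [in LHS]mulrC.
Qed.

Lemma sqrt2_sqr : sqrt2 R * sqrt2 R = 2.
Proof.
have -> : sqrt2 R = (Num.sqrt 2)%:C%C by [].
by rewrite -rmorphM /= -expr2 sqr_sqrtr ?ler0n // rmorph_nat.
Qed.

Lemma annihilation_creation k l v :
  annihilation_lin k.+1 (creation_lin l.+1 v) =
  creation_lin l.+1 (annihilation_lin k.+1 v) +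
    (if l == k then (- (2 / k.+1%:R)) *: v else 0).
Proof.
rewrite !creation_linE !annihilation_linE.
apply: etrans (scaled_commutator _ _ (a_pos_neg k l v)) _.
congr (_ + _); case: eqP => [->|_]; last by rewrite mulr0 scale0r.
congr (_ *: _); rewrite mul1r mulrAC mulNr mulrVK ?unitfE ?pnatr_eq0 //.
by rewrite mulrA mulNr sqrt2_sqr mulNr.
Qed.

Lemma shift_creation s k v :
  shift s (creation_lin k.+1 v) = creation_lin k.+1 (shift s v).
Proof. by rewrite !creation_linE linearZ /= shift_a_neg. Qed.

Lemma shift_annihilation s k v :
  shift s (annihilation_lin k.+1 v) = annihilation_lin k.+1 (shift s v).
Proof. by rewrite !annihilation_linE linearZ /= shift_a_pos. Qed.

(** The basis of the Fock module of momentum m sqrt2, all of it or the part of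
    weight less than w. *)
Definition in_sector (m : int) (b : fock_index) : Prop := b.1 = m.

Definition in_sector_lt (m : int) (w : nat) (b : fock_index) : Prop :=
  b.1 = m /\ (fock_weight b.2 < w)%N.

Lemma creation_sector m k (v : L) :
  supported (in_sector m) v -> supported (in_sector m) (creation_lin k.+1 v).
Proof.
apply: supported_linear => b bm; rewrite creation_linE.
by apply: supportedZ; rewrite [a_ _ _]a_neg_basis; apply: supportedU.
Qed.

Lemma annihilation_sector_lt m k w (v : L) :
  supported (in_sector_lt m w) v ->
  supported (in_sector_lt m (w - k.+1)) (annihilation_lin k.+1 v).
Proof.
apply: supported_linear => b [bm ltbw]; rewrite annihilation_linE.
apply: supportedZ; case: (posnP (b.2 k)) => [bk0|bk].
  by rewrite [a_ _ _]a_pos_basis_eq0 //; apply: supported0.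
rewrite [a_ _ _]a_pos_basis; apply: supportedZ; apply: supportedU; split=> //=.
by rewrite (fock_weight_div bk) in ltbw; rewrite ltn_subRL addnC.
Qed.

Lemma annihilation_sector m k (v : L) :
  supported (in_sector m) v -> supported (in_sector m) (annihilation_lin k.+1 v).
Proof.
apply: supported_linear => b bm; rewrite annihilation_linE.
by rewrite [a_ _ _]a_pos_basis; do 2![apply: supportedZ]; apply: supportedU.
Qed.

Lemma shift_sector s m (v : L) :
  supported (in_sector m) v -> supported (in_sector (m + s)) (shift s v).
Proof.
apply: supported_linear => b bm.
rewrite -[X in supported _ X]/(shift s (fock_basis b)) shift_basis.
by apply: supportedU; rewrite /in_sector /= bm.
Qed.

End FockSpace.

(** * Commutation and square of the current e(z) *)

Section VertexModes.
Context (R : realType).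
Local Notation C := R[i].
Local Notation L := (L01 R).
Local Notation x := (@creation_lin R).
Local Notation y := (@annihilation_lin R).
Implicit Types v u : L.

Lemma annihilation_exp_sector_lt m (k w : nat) v :
  supported (in_sector_lt m w) v ->
  supported (in_sector_lt m (w - k)) (exp_coefz y k%:Z v).
Proof.
move=> vm; apply: (@exp_coefz_filtration _ _ y
  (fun w (u : L) => supported (in_sector_lt m w) u)) => //.
- by move=> ?; apply: supported0.
- by move=> ? u1 u2; apply: supportedD.
- by move=> ? c u; apply: supportedZ.
- by move=> ? u1 u2; apply: annihilation_sector_lt.
Qed.

(** Degree k lowers the weight by k, and there is no negative weight. *)
Lemma annihilation_exp_eq0 m (k w : nat) v :
  supported (in_sector_lt m w) v -> (w <= k)%N -> exp_coefz y k%:Z v = 0.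
Proof.
move=> /(@annihilation_exp_sector_lt _ k) + lewk; rewrite (eqnP lewk) => Akv.
by apply: supported_False => b /Akv[].
Qed.

Lemma exp_sector (z : nat -> {linear L -> L}) m (p : int) v :
    (forall k u, supported (in_sector m) u -> supported (in_sector m) (z k.+1 u)) ->
  supported (in_sector m) v -> supported (in_sector m) (exp_coefz z p v).
Proof.
move=> zm vm; case: p => p; last first.
  by rewrite exp_coefz_lt0 //; apply: supported0.
apply: (@exp_coefz_filtration _ _ z
  (fun _ (u : L) => supported (in_sector m) u) _ _ _ _ p 0%N v vm).
- by move=> ?; apply: supported0.
- by move=> ? u1 u2; apply: supportedD.
- by move=> ? c u; apply: supportedZ.
- by move=> k ? u; apply: zm.
Qed.

Lemma mode_sum_sector m M X v :
  supported (in_sector m) v -> supported (in_sector m) (mode_sum x y M X v).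
Proof.
move=> vm; apply: supported_sum => k _.
apply: exp_sector; first exact: creation_sector.
by apply: exp_sector => //; apply: annihilation_sector.
Qed.

Lemma mode_sum_is_linear M X : linear (mode_sum x y M X).
Proof.
move=> c u v; rewrite /mode_sum scaler_sumr -big_split; apply: eq_bigr => k _ /=.
by rewrite !linearP.
Qed.

HB.instance Definition _ M X :=
  GRing.isLinear.Build C L L _ (mode_sum x y M X) (mode_sum_is_linear M X).

Lemma shift_exp s (z : nat -> {linear L -> L}) (p : int) v :
    (forall i j u, z i.+1 (z j.+1 u) = z j.+1 (z i.+1 u)) ->
    (forall k u, shift s (z k.+1 u) = z k.+1 (shift s u)) ->
  shift s (exp_coefz z p v) = exp_coefz z p (shift s v).
Proof.
move=> zC sz.
rewrite (@exp_coefz_commutator _ _ z zC (shift s) 0 0) ?scale0r ?addr0 //.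
by move=> k u; rewrite scale0r if_same addr0; apply: sz.
Qed.

Lemma shift_mode_sum s M X v :
  shift s (mode_sum x y M X v) = mode_sum x y M X (shift s v).
Proof.
rewrite /mode_sum linear_sum; apply: eq_bigr => k _ /=.
rewrite (shift_exp _ _ (@creationC R)); last exact: shift_creation.
by rewrite (shift_exp _ _ (@annihilationC R)) //; apply: shift_annihilation.
Qed.

Lemma e_basis n m M (b : fock_index) : in_sector_lt m M b ->
  e_ n (fock_basis R b) =
  shift 1 (mode_sum x y M (- (2 * m) - n - 1) (fock_basis R b)).
Proof.
case=> bm ltbM; rewrite [LHS]lin_extU /mode_sum linear_sum /=.
rewrite (big_ord_widen M (fun k =>
  match k%:Z - 2 * 1 * b.1 - n - 1 with
   | Posz p => shift 1 (creation_part 1 p (annihilation_part 1 k << b >>))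
   | Negz _ => 0 end)) //.
rewrite big_mkcond; apply: eq_bigr => k _ /=.
have -> : k%:Z + (- (2 * m) - n - 1) = k%:Z - 2 * 1 * b.1 - n - 1 by lia.
case: ltnP => [ltkb | lebk].
  case: (k%:Z - 2 * 1 * b.1 - n - 1) => [//|p].
  by rewrite exp_coefz_lt0 // linear0.
rewrite (@annihilation_exp_eq0 b.1 k (fock_weight b.2).+1) //.
  by rewrite !linear0.
by apply: supportedU; split.
Qed.

(** Replaces the truncation that depends on each basis vector by a common one,
    so that the mode becomes a fixed linear operator on the vector. *)
Lemma e_mode_sum n m M v : supported (in_sector_lt m M) v ->
  e_ n v = shift 1 (mode_sum x y M (- (2 * m) - n - 1) v).
Proof.
apply: (@eq_on_basis _ _ _ (lin_ext _)
  (shift 1 \o mode_sum x y M (- (2 * m) - n - 1))) => b.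
exact: e_basis.
Qed.

Lemma sector_ltW m w v : supported (in_sector_lt m w) v -> supported (in_sector m) v.
Proof. by move=> vmw b /vmw[]. Qed.

Lemma sector_lt_exists m v : supported (in_sector m) v ->
  exists w0, forall w, (w0 <= w)%N -> supported (in_sector_lt m w) v.
Proof.
move=> vm; exists (\max_(b <- msupp v) (fock_weight b.2)).+1 => w lew b bv.
split; first exact: vm.
apply: leq_trans lew; rewrite ltnS.
by rewrite (big_fsetD1 b) //= leq_maxl.
Qed.

Lemma e_in_sector n m v :
  supported (in_sector m) v -> supported (in_sector (m + 1)) (e_ n v).
Proof.
move=> vm; have [w /(_ w (leqnn w)) vmw] := sector_lt_exists vm.
by rewrite (e_mode_sum _ vmw); apply/shift_sector/mode_sum_sector.
Qed.

Lemma e_comp n l m M v : supported (in_sector_lt m M) v ->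
  e_ n (e_ l v) = shift 1 (shift 1
    (mode_pair x y M (- (2 * m) - n - 1) (- (2 * m) - l - 1) v)).
Proof.
move=> vM; have vm := sector_ltW vM.
have [w e_w] := sector_lt_exists (@e_in_sector l _ _ vm).
rewrite (e_mode_sum n (e_w (maxn w (M + 2)) (leq_maxl _ _))) (e_mode_sum l vM).
rewrite -shift_mode_sum; congr (shift 1 (shift 1 _)).
have -> : - (2 * (m + 1)) - n - 1 = - (2 * m) - n - 1 - 2 by lia.
apply: mode_sum_comp; last exact: leq_maxr.
- exact: creationC.
- exact: annihilationC.
- exact: annihilation_creation.
- by move=> k; apply: annihilation_exp_eq0 vM.
Qed.

Lemma e_commute n l m v : supported (in_sector m) v ->
  e_ n (e_ l v) = e_ l (e_ n v).
Proof.
move=> vm; have [w /(_ w (leqnn w)) vmw] := sector_lt_exists vm.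
rewrite (e_comp n l vmw) (e_comp l n vmw).
by rewrite (mode_pairC (@creationC R) (@annihilationC R) w (- (2 * m) - n - 1)).
Qed.

(** e(z)^2 = 0 in the coefficient T, for windows of indices so large that they
    contain all nonzero terms. *)
Lemma e_square_large m v : supported (in_sector m) v ->
  forall T : int, exists J0 : nat, forall J K : nat, (J0 <= J)%N -> (J0 + J <= K)%N ->
    \sum_(t < K) e_ (J%:Z - t%:Z) (e_ (T - J%:Z + t%:Z) v) = 0.
Proof.
move=> vm T; have [w /(_ w (leqnn w)) vmw] := sector_lt_exists vm.
exists (w + `|m| + `|m| + `|T|)%N => J K leJ leK.
pose X := - (2 * m) - J%:Z - 1; pose Y := - (2 * m) - T + J%:Z - 1.
rewrite (eq_bigr (fun t : 'I_K =>
    shift 1 (shift 1 (mode_pair x y w (X + t%:Z) (Y - t%:Z) v)))).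
  rewrite -2!linear_sum (sum_mode_pair (@creationC R) (@annihilationC R)).
  - by rewrite !linear0.
  - by rewrite /X; lia.
  - by rewrite /Y; lia.
move=> t _; rewrite (e_comp _ _ vmw).
have -> : - (2 * m) - (J%:Z - t%:Z) - 1 = X + t%:Z by rewrite /X; lia.
by have -> : - (2 * m) - (T - J%:Z + t%:Z) - 1 = Y - t%:Z by rewrite /Y; lia.
Qed.

(** When e_n v = 0 above N, commutation kills all the terms of the large window
    in which one of the two indices exceeds N; what is left is a sum over the
    pairs of indices N - t and N - (T - t) with 0 <= t <= T. *)
Lemma e_square m N v : supported (in_sector m) v ->
    (forall n, N < n -> e_ n v = 0) ->
  forall T : nat, \sum_(t < T.+1) e_ (N - t%:Z) (e_ (N - (T - t)%N%:Z) v) = 0.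
Proof.
move=> vm eN0 T; have [J0 sum0] := e_square_large vm (2 * N - T%:Z).
pose J := (J0 + `|N| + T)%N; pose K := (J0 + J0 + T + J + J + `|N| + `|N|).+1.
pose f (k : int) := e_ (N - k) (e_ (N - T%:Z + k) v).
have e0 n : e_ n (0 : L) = 0 by exact: linear0.
have [J1 eqJ1] : exists J1 : nat, N + J%:Z = J1%:Z.
  by exists (absz (N + J%:Z)); rewrite /J; lia.
transitivity (\sum_(k < T.+1) f k%:Z).
  apply: eq_bigr => k _; rewrite /f.
  by have -> : N - (T - k)%N%:Z = N - T%:Z + k%:Z by have := ltn_ord k; lia.
rewrite -(@sum_shift _ f T.+1 J K) => [|k k_lt0|k leTk|].
- rewrite -[RHS](sum0 J1 K); [|by rewrite /J in eqJ1; lia|by rewrite /K; lia].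
  apply: eq_bigr => t _; rewrite /f.
  have -> : N - (t%:Z - J%:Z) = J1%:Z - t%:Z by lia.
  by have -> : N - T%:Z + (t%:Z - J%:Z) = 2 * N - T%:Z - J1%:Z + t%:Z by lia.
- by rewrite /f (e_commute _ _ vm) eN0 ?e0 //; lia.
- by rewrite /f eN0 ?e0 //; lia.
- by rewrite /K; lia.
Qed.

Lemma vac_sector j : supported (in_sector_lt j 1) (vac R j).
Proof.
by apply: supportedU; split; rewrite //= /fock_weight mdom1 big_seq_fset0.
Qed.

(** On a highest weight vector only k = 0 contributes to e_n, in creation degree
    -2j - n - 1, which is negative. *)
Lemma e_vac (j n : int) : -2 * j - 1 < n -> e_ n (vac R j) = 0.
Proof.
move=> ltn; rewrite (e_mode_sum n (@vac_sector j)) /mode_sum big_ord1.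
by rewrite exp_coefz_lt0 ?linear0 //=; lia.
Qed.

End VertexModes.

(** * Straightening modulo a quadratic relation *)

(** Commutation is only assumed on the vectors generated from v, which is all
    that reordering a product applied to v uses. *)
Section OrderedProducts.
Context (I : eqType) (V : Type) (x : I -> V -> V) (v : V).

Local Notation act := (foldr x v).

Hypothesis xC : forall i j s, x i (x j (act s)) = x j (x i (act s)).

Lemma foldr_middle i s1 s2 : act (s1 ++ i :: s2) = act (i :: s1 ++ s2).
Proof. by elim: s1 => //= j s1 ->; rewrite /= xC. Qed.

Lemma foldr_perm s t : perm_eq s t -> act s = act t.
Proof.
elim: s t => [|i s IHs] t; first by rewrite perm_sym => /perm_nilP ->.
move=> eq_st; have it : i \in t by rewrite -(perm_mem eq_st) mem_head.
case/splitPr: it eq_st => t1 t2.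
rewrite perm_sym perm_catC /= perm_cons perm_catC perm_sym.
by rewrite foldr_middle /= => /IHs ->.
Qed.

End OrderedProducts.

Definition sum_squares (s : seq nat) : nat := sumn [seq (d ^ 2)%N | d <- s].

Lemma sum_squares_le s : (sum_squares s <= sumn s ^ 2)%N.
Proof.
elim: s => [//|d s IHs]; rewrite /sum_squares /= in IHs *.
by rewrite sqrnD -addnA leq_add2l (leq_trans IHs) // leq_addr.
Qed.

Lemma spread_squares_lt a b t u :
  (t < a -> a <= b -> t + u = a + b -> a ^ 2 + b ^ 2 < t ^ 2 + u ^ 2)%N.
Proof.
move=> lta leab tu; have [q eq_a] : exists q, a = (t + q.+1)%N.
  by exists (a - t).-1%N; lia.
have eq_u : u = (b + q.+1)%N by lia.
have : (t * q.+1 < b * q.+1)%N by rewrite ltn_pmul2r //; lia.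
rewrite eq_a eq_u !sqrnD; lia.
Qed.

(** Among the pairs with a given sum, the closest ones have the least sum of
    squares. *)
Lemma spread_squares a b t :
  (a <= b <= a.+1 -> t <= a + b -> t != a -> t != b ->
  a ^ 2 + b ^ 2 < t ^ 2 + (a + b - t) ^ 2)%N.
Proof.
move=> /andP[leab leba] let_ab ta tb; have [lta|leat] := ltnP t a.
  by apply: spread_squares_lt => //; lia.
by rewrite [X in (_ < X)%N]addnC; apply: spread_squares_lt; lia.
Qed.

Lemma close_pair (s : seq nat) :
  sorted leq s -> ~~ sorted (fun a b => a.+1 < b)%N s ->
  exists s1 a b s2, s = s1 ++ a :: b :: s2 /\ (a <= b <= a.+1)%N.
Proof.
elim: s => [//|a [//|b s] IHs].
move=> /= /andP[leab sorted_s]; rewrite negb_and -leqNgt => /orP[leba|gap_s].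
  by exists [::], a, b, s; rewrite leab.
have [s1 [c [d [s2 [-> lecd]]]]] := IHs sorted_s gap_s.
by exists (a :: s1), c, d, s2.
Qed.

Section Straightening.
Context (F : numFieldType) (V : lmodType F) (x : nat -> V -> V) (v : V).

Local Notation act := (foldr x v).

Hypothesis xC : forall a b s, x a (x b (act s)) = x b (x a (act s)).
Hypothesis x_square : forall T s, \sum_(t < T.+1) x t (x (T - t)%N (act s)) = 0.

(** Induction on (\sum d)^2 - \sum d^2, which decreases when a close pair is
    replaced, through the relation, by pairs with the same sum that are further
    apart. *)
Lemma straightening (P : V -> Prop) :
    P 0 -> (forall u w, P u -> P w -> P (u + w)) ->
    (forall c u, P u -> P (c *: u)) ->
    (forall s, sorted (fun a b => a.+1 < b)%N s -> P (act s)) ->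
  forall s, P (act s).
Proof.
move=> P0 PD PZ Psorted s.
have [n] := ubnP (sumn s ^ 2 - sum_squares s)%N; elim: n s => // n IHn s len.
rewrite (foldr_perm xC (s := s) (t := sort leq s)); last first.
  by rewrite perm_sym perm_sort.
have [/Psorted//|gap_s] := boolP (sorted (fun a b => a.+1 < b)%N (sort leq s)).
have [s1 [a [b [s2 [eq_s leab]]]]] := close_pair (sort_sorted leq_total s) gap_s.
have perm_s : perm_eq s [:: a, b & s1 ++ s2].
  rewrite -(perm_sort leq) eq_s perm_catC /= perm_cons perm_cons.
  by rewrite perm_catC.
rewrite (foldr_perm xC (s := sort leq s) (t := [:: a, b & s1 ++ s2])); last first.
  by rewrite perm_sort.
move: (s1 ++ s2) perm_s => r perm_s {s1 s2 eq_s gap_s}.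
have sum_s : sumn s = (a + b + sumn r)%N.
  by rewrite (perm_sumn perm_s) /= addnA.
have squares_s : sum_squares s = (a ^ 2 + b ^ 2 + sum_squares r)%N.
  by rewrite /sum_squares (perm_sumn (perm_map _ perm_s)) /= addnA.
(* The close pair occurs once or twice in the relation, according to whether
   a = b; the count is invertible in either case. *)
pose near (t : 'I_(a + b).+1) := (t == a :> nat) || (t == b :> nat).
have near_a : near (inord a) by rewrite /near inordK ?eqxx // ltnS leq_addr.
have card_near : (#|near|%:R : F) != 0.
  by rewrite pnatr_eq0 -lt0n; apply/card_gt0P; exists (inord a).
have eq_near : #|near|%:R *: act [:: a, b & r] =
    - \sum_(t < (a + b).+1 | ~~ near t) act [:: nat_of_ord t, (a + b - t)%N & r].
  apply/eqP; rewrite -addr_eq0; apply/eqP.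
  rewrite -[RHS](x_square (a + b) r) [RHS](bigID near) /=.
  rewrite scaler_nat -sumr_const; congr (_ + _).
  apply: eq_bigr => t /orP[] /eqP ->; first by rewrite addKn.
  by rewrite addnK /= xC.
rewrite -[act _]scale1r -(mulVf card_near) -scalerA eq_near -scaleN1r.
apply/PZ/PZ; elim/big_ind: _ => // t; rewrite negb_or => /andP[ta tb].
apply: (IHn [:: nat_of_ord t, (a + b - t)%N & r]).
rewrite ltnS in len; apply: leq_trans len.
have le_t := sum_squares_le [:: nat_of_ord t, (a + b - t)%N & r].
have lt_t : (t <= a + b)%N by rewrite -ltnS.
have := spread_squares leab lt_t ta tb; move: le_t.
rewrite sum_s squares_s /sum_squares /= [(t + (_ + _))%N]addnA subnKC //.
set S := sumn [seq _ | _ <- r]; set n0 := ((_ + _) ^ 2)%N => le_t lt_ab.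
by apply: ltn_sub2l; [apply: leq_trans le_t|]; rewrite addnA ltn_add2r.
Qed.

End Straightening.

(** * Monomials in the e_i and the span of the Fibonacci ones *)

(** The factors of the monomial in the order in which [emonom_act] applies
    them. *)
Definition monom_seq (m : {cmonom int}) : seq int :=
  flatten [seq nseq (m i) i | i <- sort <=%O (finsupp m)].

Definition monom_of_seq (s : seq int) : {cmonom int} :=
  \big[mmul/mone]_(i <- s) ucm i.

Lemma count_monom_seq m i : count_mem i (monom_seq m) = m i.
Proof.
rewrite /monom_seq count_flatten -map_comp sumnE big_map.
rewrite (perm_big (finsupp m)) ?perm_sort //=.
under eq_bigr => k _ do rewrite count_nseq.
case: (mdomP m i) => [im | im].
  rewrite (big_fsetD1 i) //= eqxx mul1n big1_seq ?addn0 // => k.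
  by case/andP=> _; rewrite in_fsetD1 => /andP[/negPf ->].
rewrite big1_seq // => k /andP[_ km] /=.
by case: eqP km im => // -> ->.
Qed.

Lemma monom_of_seqE s i : monom_of_seq s i = count_mem i s.
Proof.
rewrite /monom_of_seq; elim: s => [|j s IHs]; first by rewrite big_nil cm1.
by rewrite big_cons cmM cmU IHs /=.
Qed.

Lemma perm_monom_of_seqK s : perm_eq (monom_seq (monom_of_seq s)) s.
Proof.
by apply/allP => i _ /=; rewrite count_monom_seq monom_of_seqE.
Qed.

Lemma mem_monom_seq m i : (i \in monom_seq m) = (i \in finsupp m).
Proof. by rewrite -has_pred1 has_count count_monom_seq lt0n cmE_neq0. Qed.

Section LinearSpan.
Context (F : fieldType) (V : lmodType F) (A : set V).

Lemma lin_span0 : lin_span A 0.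
Proof. by exists [::]; rewrite ?big_nil. Qed.

Lemma lin_spanD u v :
  lin_span A u -> lin_span A v -> lin_span A (u + v).
Proof.
move=> [s sA ->] [t tA ->]; exists (s ++ t); rewrite ?big_cat // => p.
by rewrite mem_cat => /orP[/sA|/tA].
Qed.

Lemma lin_spanZ c u :
  lin_span A u -> lin_span A (c *: u).
Proof.
move=> [s sA ->]; exists [seq (c * p.1, p.2) | p <- s].
  by move=> _ /mapP[p /sA Ap ->].
by rewrite big_map scaler_sumr; apply: eq_bigr => p _; rewrite scalerA.
Qed.

Lemma lin_spanU u : A u -> lin_span A u.
Proof.
move=> Au; exists [:: (1, u)]; last by rewrite big_seq1 scale1r.
by move=> p; rewrite inE => /eqP ->.
Qed.

End LinearSpan.

Section Orbits.
Context (R : realType) (j : int).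
Local Notation L := (L01 R).
Local Notation N := (-2 * j - 1).
Local Notation act := (foldr (@e_ R) (vac R j)).

Lemma e0 n : e_ n (0 : L) = 0.
Proof. exact: (linear0 (lin_ext _)). Qed.

Lemma act_sector s : supported (in_sector (j + (size s)%:Z)) (act s).
Proof.
elim: s => [|i s IHs] /=; first by rewrite addr0; apply: sector_ltW (@vac_sector R j).
have -> : j + (size s).+1%:Z = j + (size s)%:Z + 1 by lia.
exact: e_in_sector.
Qed.

Lemma act_commute i k s : e_ i (e_ k (act s)) = e_ k (e_ i (act s)).
Proof. exact: (e_commute i k (@act_sector s)). Qed.

Lemma e_act_gt n s : N < n -> e_ n (act s) = 0.
Proof.
move=> ltNn; elim: s => [|i s IHs] /=; first exact: e_vac.
by rewrite act_commute IHs e0.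
Qed.

Lemma emonom_actE m : emonom_act m (vac R j) = act (monom_seq m).
Proof.
rewrite /emonom_act /monom_seq; elim: (sort _ _) => //= i s ->.
rewrite foldr_cat; elim: (m i) => [//|k IHk].
exact: (congr1 (@e_ R i) IHk).
Qed.

Lemma emonom_act_of_seq s : emonom_act (monom_of_seq s) (vac R j) = act s.
Proof.
rewrite emonom_actE; apply: foldr_perm (perm_monom_of_seqK s).
by move=> *; apply: act_commute.
Qed.

Local Notation fib_orbit := (epoly_orbit (epoly_fib1 N) (vac R j)).

Lemma fib_orbit0 : fib_orbit 0.
Proof. by exists 0; [exact: lin_span0|exact: (linear0 (lin_ext _))]. Qed.

Lemma fib_orbitD u v : fib_orbit u -> fib_orbit v -> fib_orbit (u + v).
Proof.
move=> [f Af <-] [g Ag <-]; exists (f + g); first exact: lin_spanD.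
exact: (linearD (lin_ext _)).
Qed.

Lemma fib_orbitZ c u : fib_orbit u -> fib_orbit (c *: u).
Proof.
move=> [f Af <-]; exists (c *: f); first exact: lin_spanZ.
exact: (linearZ_LR (lin_ext _)).
Qed.

(** Increasing distances d = N - i are decreasing indices i, hence the reversal. *)
Lemma fib_orbit_fibonacci s : sorted (fun a b => a.+1 < b)%N s ->
  fib_orbit (act [seq N - d%:Z | d <- s]).
Proof.
move=> sorted_s; set t := [seq _ | d <- s].
have tN i : i \in t -> i <= N by case/mapP=> d _ ->; lia.
exists << monom_of_seq t >>; last first.
  by rewrite [LHS]lin_extU emonom_act_of_seq.
apply: lin_spanU; exists (monom_of_seq t) => //; split; last first.
  move=> i; rewrite -mem_monom_seq (perm_mem (perm_monom_of_seqK t)); exact: tN.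
exists (rev t); last first.
  by rewrite /monom_of_seq; apply: perm_big; rewrite perm_sym perm_rev.
rewrite rev_sorted sorted_map; apply: sub_sorted sorted_s => a b /= ltab; lia.
Qed.

(** A product with an index above N vanishes, since that factor can be moved next
    to the vacuum; the others are straightened. *)
Lemma fib_orbit_act s : fib_orbit (act s).
Proof.
have [/allP sN|] := boolP (all (fun i => i <= N) s); last first.
  case/allPn => i /splitPr[s1 s2]; rewrite -ltNge => ltNi.
  rewrite foldr_middle; last by move=> *; apply: act_commute.
  by rewrite /= e_act_gt //; apply: fib_orbit0.
have -> : s = [seq N - d%:Z | d <- [seq `|N - i|%N | i <- s]].
  rewrite -map_comp map_id_in // => i /sN leiN /=.
  by rewrite gez0_abs ?subr_ge0 // opprB addrC subrK.
have actE t : foldr (fun d : nat => e_ (N - d%:Z)) (vac R j) t =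
    act [seq N - d%:Z | d <- t] by rewrite foldr_map.
rewrite -actE; apply: straightening.
- by move=> a b t; rewrite !actE; apply: act_commute.
- move=> T t; rewrite actE.
  exact: (e_square (@act_sector _) (fun n => @e_act_gt n _)).
- exact: fib_orbit0.
- exact: fib_orbitD.
- exact: fib_orbitZ.
- by move=> t sorted_t; rewrite actE; apply: fib_orbit_fibonacci.
Qed.

Lemma fib_orbit_epoly g : fib_orbit (epoly_act g (vac R j)).
Proof.
rewrite /epoly_act /lin_ext; elim/big_ind: _ => [|u v|m _].
- exact: fib_orbit0.
- exact: fib_orbitD.
- by apply: fib_orbitZ; rewrite emonom_actE; apply: fib_orbit_act.
Qed.

Lemma epoly_fib1_le : (epoly_fib1 N `<=` (epoly_le N : set (epoly R)))%classic.
Proof.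
move=> g [s sA ->]; rewrite big_seq.
apply: (@supported_sum _ _ (emonom_le N)) => p /sA[m [_ mN] <-].
by apply: supportedZ; apply: supportedU.
Qed.

End Orbits.

Theorem lemma1p2 (R : realType) (j : int) :
  W j = epoly_orbit (epoly_le (-2 * j - 1)) (vac R j) /\
  epoly_orbit (epoly_le (-2 * j - 1)) (vac R j) =
    epoly_orbit (epoly_fib1 (-2 * j - 1)) (vac R j).
Proof.
have orbitS (A B : set (epoly R)) : (A `<=` B)%classic ->
    (epoly_orbit A (vac R j) `<=` epoly_orbit B (vac R j))%classic.
  by move=> AB; apply: image_subset.
have to_fib A : (epoly_orbit A (vac R j) `<=`
    epoly_orbit (epoly_fib1 (-2 * j - 1)) (vac R j))%classic.
  by move=> _ [g _ <-]; apply: fib_orbit_epoly.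
have from_fib := orbitS _ _ (@epoly_fib1_le R j).
split; apply/seteqP; split=> //.
- exact: subset_trans (to_fib _) from_fib.
- exact: orbitS.
Qed.
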